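(* Let $m$ be a square-free positive integer, let $E=\mathbb{Q}(\sqrt{-m})$, and let $\mathfrak{O}$ be its ring of integers. If $m\notin\{1,2,3,7,11\}$, then there is no $2$-universal ternary Hermitian $\mathfrak{O}$-lattice. Moreover, for every square-free positive integer $m$, every $2$-universal ternary Hermitian $\mathfrak{O}$-lattice over $\mathbb{Q}(\sqrt{-m})$ is free (as an $\mathfrak{O}$-module).
   Context: A Hermitian $\mathfrak{O}$-lattice is a finitely generated $\mathfrak{O}$-submodule $L$ of a finite-dimensional $E$-vector space equipped with a form $H$ that is linear in the first variable, satisfies $H(x,y)=\overline{H(y,x)}$ (bar is complex conjugation), and has $H(L,L)\subseteq\mathfrak{O}$. Its rank is $\dim_E EL$; binary means rank 2, ternary means rank 3. It need not be free. It is positive (definite) if $H(v):=H(v,v)>0$ for all $0\neq v\in L$; all lattices are assumed positive. The Gram matrix of a free lattice with basis $v_1,\dots,v_n$ is $M_L=(H(v_i,v_j))$; for a nonfree lattice, written $L=\mathfrak{O}w_1+\dots+\mathfrak{O}w_{n-1}+\mathfrak{O}\alpha w_n+\mathfrak{O}\beta w_n$, the formal Gram matrix $M_L$ is the $(n+1)\times(n+1)$ matrix of values of $H$ on the generators $w_1,\dots,w_{n-1},\alpha w_n,\beta w_n$. $L$ represents $\ell$ (written $\ell\to L$) if $M_\ell=XM_LX^*$ for some matrix $X$ over $\mathfrak{O}$, where $X^*$ is the conjugate transpose (equivalently, for positive lattices, there is an $\mathfrak{O}$-linear map $\ell\to L$ preserving $H$). A positive Hermitian $\mathfrak{O}$-lattice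 is $2$-universal if it represents all binary positive Hermitian $\mathfrak{O}$-lattices (free or not). *)

(* Defs.v *)
From HB Require Import structures.
From mathcomp Require Import all_boot all_order all_algebra all_field.
From mathcomp Require Import ring.

Set Implicit Arguments.
Unset Strict Implicit.
Unset Printing Implicit Defensive.

Import Order.TTheory GRing.Theory Num.Theory.
Local Open Scope ring_scope.

Definition squarefree (m : nat) : Prop := forall d : nat, (d ^ 2 %| m)%N -> d = 1%N.

(* Q(sqrt(-m)) is realized inside the algebraic numbers as Q + Q sqrt(-m), so
   that conjugation, algebraic integers and positivity are those of algC. *)
Definition quad_pred (m : nat) : {pred algC} :=
  Crat_span [:: 1; sqrtC (- m%:R)].

Section QuadPred.
Variable m : nat.
Local Notation s := (sqrtC (- m%:R) : algC).

Lemma quad_predP (x : algC) :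
  reflect (exists a b : rat, x = ratr a + ratr b * s) (x \in quad_pred m).
Proof.
apply: (iffP (Crat_spanP _ _)) => [[a ->]|[a [b ->]]].
  by exists (a ord0), (a (lift ord0 ord0)); rewrite !big_ord_recl big_ord0 /= mulr1 addr0.
exists [ffun i : 'I_2 => if i == 0 then a else b].
by rewrite !big_ord_recl big_ord0 /= !ffunE /= mulr1 addr0.
Qed.

Lemma quad_sqrt_conj : s^* = s \/ s^* = - s.
Proof.
have : s^* ^+ 2 == s ^+ 2 by rewrite -rmorphXn /= sqrtCK rmorphN rmorph_nat.
by rewrite eqf_sqr => /orP[] /eqP; [left|right].
Qed.

Lemma quad_conjE (a b : rat) :
  (ratr a + ratr b * s)^* = ratr a + ratr b * s^*.
Proof.
rewrite rmorphD [X in _ + X]rmorphM; congr (_ + _ * _).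
  exact: conj_Crat (Crat_rat a).
exact: conj_Crat (Crat_rat b).
Qed.

Lemma quad_pred_conj (x : algC) : x \in quad_pred m -> x^* \in quad_pred m.
Proof.
case/quad_predP=> a [b ->]; apply/quad_predP; rewrite quad_conjE.
case: quad_sqrt_conj => ->; first by exists a, b.
by exists a, (- b); rewrite mulrN rmorphN mulNr.
Qed.

Lemma quad_predM : {in quad_pred m &, forall x y, x * y \in quad_pred m}.
Proof.
move=> x y /quad_predP[a [b ->]] /quad_predP[c [d ->]]; apply/quad_predP.
exists (a * c - b * d * m%:R), (a * d + b * c).
have -> : ratr (a * c - b * d * m%:R) = ratr a * ratr c - ratr b * ratr d * m%:R :> algC.
  by rewrite rmorphB !rmorphM /= rmorph_nat.
have -> : ratr (a * d + b * c) = ratr a * ratr d + ratr b * ratr c :> algC.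
  by rewrite rmorphD !rmorphM.
have ss : s * s = - m%:R by rewrite -expr2 sqrtCK.
by move: (ratr a) (ratr b) (ratr c) (ratr d) (s) ss => A B C D t tt; ring: tt.
Qed.

Lemma quad_pred_divring_closed : divring_closed (quad_pred m).
Proof.
split; first by apply: mem_Crat_span; rewrite inE eqxx.
  by move=> x y; apply: rpredB.
move=> x y xE yE; rewrite quad_predM //.
have [-> | y0] := eqVneq y 0; first by rewrite invr0 rpred0.
have yy : y * y^* \in Crat.
  case/quad_predP: yE => a [b ->]; rewrite quad_conjE.
  have sE : s ^+ 2 \in Crat by rewrite sqrtCK rpredN rpred_nat.
  case: quad_sqrt_conj => sc; last first.
    rewrite sc; move: (ratr a) (ratr b) (Crat_rat a) (Crat_rat b) => A B AQ BQ.
    by rewrite mulrN mulrC -subr_sqr exprMn rpredB ?(rpredX 2 AQ) // rpredM // rpredX.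
  have sR : s \is Num.real by rewrite CrealE sc.
  have m0 : s = 0.
    apply/eqP; rewrite -sqrf_eq0 eq_le real_exprn_even_ge0 // andbT.
    by rewrite sqrtCK oppr_le0 ler0n.
  by rewrite sc m0 !mulr0 !addr0; apply: rpredM; apply: Crat_rat.
have -> : y^-1 = (y * y^*)^-1 * y^*.
  by rewrite invfM -mulrA mulVf ?mulr1 // fmorph_eq0.
by apply: Crat_spanM; rewrite ?rpredV ?quad_pred_conj.
Qed.

HB.instance Definition _ :=
  GRing.isDivringClosed.Build algC (quad_pred m) quad_pred_divring_closed.

End QuadPred.

Record quad (m : nat) : predArgType :=
  Quad { quad_val : algC; quad_valP : quad_val \in quad_pred m }.

Section QuadField.
Variable m : nat.

HB.instance Definition _ := [isSub for @quad_val m].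
HB.instance Definition _ := [Choice of quad m by <:].
HB.instance Definition _ :=
  [SubChoice_isSubComUnitRing of quad m by <:].
HB.instance Definition _ :=
  [SubComUnitRing_isSubIntegralDomain of quad m by <:].
HB.instance Definition _ :=
  [SubIntegralDomain_isSubField of quad m by <:].

Definition quad_conj (x : quad m) : quad m := Quad (quad_pred_conj (quad_valP x)).

Fact quad_conj_is_zmod_morphism : zmod_morphism quad_conj.
Proof. by move=> x y; apply: val_inj; rewrite /= !rmorphB. Qed.

Fact quad_conj_is_monoid_morphism : monoid_morphism quad_conj.
Proof. by split=> [|x y]; apply: val_inj; rewrite /= ?rmorphM ?rmorph1. Qed.

Fact quad_conjK : involutive quad_conj.
Proof. by move=> x; apply: val_inj; rewrite /= conjCK. Qed.

HB.instance Definition _ :=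
  GRing.isZmodMorphism.Build (quad m) (quad m) quad_conj quad_conj_is_zmod_morphism.
HB.instance Definition _ :=
  GRing.isMonoidMorphism.Build (quad m) (quad m) quad_conj quad_conj_is_monoid_morphism.
HB.instance Definition _ := isInvolutive.Build (quad m) quad_conj quad_conjK.

Definition quad_int : {pred quad m} := [pred x | val x \in Aint].

Fact quad_int_subring_closed : subring_closed quad_int.
Proof.
by split=> [|x y|x y]; rewrite !inE /= ?rmorph1 ?Aint1 //= => xA yA;
   rewrite ?rmorphB ?rmorphM /= ?rpredB ?rpredM.
Qed.

HB.instance Definition _ :=
  GRing.isSubringClosed.Build (quad m) quad_int quad_int_subring_closed.

End QuadField.

Arguments quad_int m : clear implicits.

Definition in_span (m : nat) (V : vectType (quad m)) (s : seq V) (x : V) : Prop :=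
  exists2 c : 'I_(size s) -> quad m,
    (forall i, c i \in quad_int m) & x = \sum_i c i *: s`_i.

(* A finitely generated submodule is given by a finite generating family,
   which need not be minimal; lspace may be larger than the span of the lattice. *)
Record lattice (m : nat) := Lattice {
  lspace : vectType (quad m);
  lform : {hermitian lspace for false & @quad_conj m};
  lgens : seq lspace;
  lform_int : forall x y : lspace,
    in_span lgens x -> in_span lgens y -> lform x y \in quad_int m
}.

Section Lattice.
Variable m : nat.
Implicit Types L l : lattice m.

Definition lmem L (x : lspace L) : Prop := in_span (lgens L) x.

Definition lrank L : nat := \dim <<lgens L>>.

(* In algC, 0 < z means that z is real and positive. *)
Definition positive L : Prop :=
  forall v : lspace L, lmem v -> v != 0 -> 0 < val (lform L v v).

Definition is_free L : Prop :=
  exists2 e : seq (lspace L),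
    forall x, lmem x <-> in_span e x &
    forall c : 'I_(size e) -> quad m, (forall i, c i \in quad_int m) ->
      \sum_i c i *: e`_i = 0 -> forall i, c i = 0.

(* The formal Gram matrix of the generating family of L; singular as soon as
   the generators are linearly dependent, as happens for nonfree L. *)
Definition gram L : 'M[quad m]_(size (lgens L)) :=
  \matrix_(i, j) lform L (lgens L)`_i (lgens L)`_j.

(* gram l = X (gram L) X^*: row i of X gives coordinates, on the generators of
   L, of the image of the i-th generator of l. For positive L this does not
   depend on the generating families: a relation between generators of l is
   mapped to a vector of norm 0, hence to 0. *)
Definition represents L l : Prop :=
  exists2 X : 'M[quad m]_(size (lgens l), size (lgens L)),
    X \is a mxOver (quad_int m) &
    gram l = X *m gram L *m map_mx (@quad_conj m) X^T.

Definition two_universal L : Prop :=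
  positive L /\ forall l, lrank l = 2%N -> positive l -> represents L l.

End Lattice.

(* Main.v *)
From HB Require Import structures.
Require Import Defs.
From mathcomp Require Import all_boot all_order all_algebra all_field.
From mathcomp Require Import ring lra zify.
From Stdlib Require Import Classical.

(** A 2-universal ternary lattice L represents the plane <1, 1>, so it contains
    an orthonormal pair e1, e2, and splits as O e1 + O e2 + M with M of rank one
    ([orthonormal_pair], [perp_complement], [complement_norm]).

    When m is not 1, 2, 3, 7 or 11, every integer of small norm is a rational
    integer ([nonreal_norm_bound]). Let v, w in L have norms 2 and c, and a
    product b = H(v, w) that is not real. If all integers of norm at most c are
    rational, then v must lie in M: a component of v along e1 or e2 would leave
    norm at most 1 for the component in M, and this makes b real
    ([two_in_complement]). As M has rank one, only very special planes can
    satisfy this. If the norm of b is odd, the plane with Gram matrix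
    [2, b; cj b, c] does not, since in M the norm of b would be twice an integer
    ([no_odd_entry]). If the norm of b is 2c, then [2, b; cj b, c] is the formal
    Gram matrix of a lattice of rank one, and two orthogonal copies of it would
    force two orthogonal nonzero vectors into M ([no_even_entry]). Suitable b
    are sqrt (- m) for m = 1 mod 4, 1 + sqrt (- m) for m = 2 mod 4, and
    (1 + sqrt (- m)) / 2, of norm (m + 1) / 4, for m = 3 mod 4, where that norm
    is odd for m = 3 mod 8 and even for m = 7 mod 8.

    This settles the first claim, and freeness for the same m holds vacuously.
    In the five remaining fields the ring of integers is Euclidean for the norm
    ([quad_euclid]), so M is generated by a shortest nonzero vector and L is
    free ([euclidean_free]). *)

Set Implicit Arguments.
Unset Strict Implicit.
Unset Printing Implicit Defensive.

Import Order.TTheory GRing.Theory Num.Theory.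
Local Open Scope ring_scope.

(** In m x^2 = d the square of the denominator of x must divide m. *)
Lemma squarefree_sqr_int (m : nat) (d : int) (x : rat) :
  squarefree m -> d%:~R = m%:R * x ^+ 2 -> exists k : int, x = k%:~R.
Proof.
move=> sqf dE.
have qn0 : (denq x)%:~R != 0 :> rat by rewrite intr_eq0 denq_neq0.
have E : d * denq x ^+ 2 = m%:Z * numq x ^+ 2.
  apply: (@intr_inj rat); rewrite !expr2 !intrM dE -[in X in X * _ = _](divq_num_den x).
  by rewrite -pmulrn; field.
have /(congr1 absz) := E; rewrite !expr2 !abszM absz_nat !mulnn => En.
have q2 : (`|denq x| ^ 2 %| m)%N.
  rewrite -(@Gauss_dvdl _ _ (`|numq x| ^ 2)); first by rewrite -En dvdn_mull.
  by rewrite coprimeXl // coprimeXr // coprime_sym coprime_num_den.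
have den1 : denq x = 1.
  by have := sqf _ q2; have := denq_gt0 x; lia.
by exists (numq x); rewrite -{1}(divq_num_den x) den1 divr1.
Qed.

(** * Integers of an imaginary quadratic field *)

Section QuadraticField.
Variable m : nat.
Hypothesis m_gt0 : (0 < m)%N.

Local Notation K := (quad m).
Local Notation O := (quad_int m).
Local Notation cj := (@quad_conj m).

Lemma quad_sqrt_subproof : sqrtC (- m%:R) \in quad_pred m.
Proof. by apply/quad_predP; exists 0, 1; rewrite rmorph0 rmorph1 add0r mul1r. Qed.

Definition quad_sqrt : K := Quad quad_sqrt_subproof.
Local Notation s := quad_sqrt.

Lemma val_natr n : val (n%:R : K) = n%:R.
Proof. exact: rmorph_nat. Qed.

Lemma quad_natr_inj : injective (fun n => n%:R : K).
Proof.
by move=> n p /(congr1 val); rewrite !val_natr => /eqP; rewrite eqr_nat => /eqP.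
Qed.

Lemma quad_natr_eq0 n : (n%:R == 0 :> K) = (n == 0)%N.
Proof. by rewrite -[0]/(0%:R) (inj_eq quad_natr_inj). Qed.

Lemma quad_sqrt2 : s * s = - m%:R.
Proof. by apply: val_inj; rewrite rmorphN rmorphM /= val_natr -expr2 sqrtCK. Qed.

Lemma quad_sqrt_neq0 : s != 0.
Proof.
apply/eqP=> s0; have := quad_sqrt2; rewrite s0 mul0r => /esym/eqP.
by rewrite oppr_eq0 quad_natr_eq0 -leqn0 leqNgt m_gt0.
Qed.

Lemma conj_quad_sqrt : cj s = - s.
Proof.
apply: val_inj; rewrite rmorphN /=.
case: (quad_sqrt_conj m) => // sc.
have sR : sqrtC (- m%:R : algC) \is Num.real by rewrite CrealE sc.
have := real_exprn_even_ge0 (n := 2) sR isT.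
by rewrite sqrtCK oppr_ge0 -[0]/(0%:R) ler_nat leqNgt m_gt0.
Qed.

Lemma val_quad_sqrt2 : val s * val s = - m%:R.
Proof. by rewrite /= -expr2 sqrtCK. Qed.

Arguments quad_sqrt : simpl never.

Lemma quadE (x : K) : exists a b : rat,
  [/\ val x = ratr a + ratr b * val s & val (cj x) = ratr a - ratr b * val s].
Proof.
case/quad_predP: (valP x) => a [b xE]; exists a, b; split => //.
rewrite /= xE quad_conjE; congr (_ + _).
by rewrite -mulrN; congr (_ * _); have := congr1 val conj_quad_sqrt; rewrite rmorphN.
Qed.

Lemma quad_real_rat (x : K) : cj x = x -> val x \in Crat.
Proof.
move=> xr; have [a [b [xE cE]]] := quadE x.
move: cE; rewrite xr xE => /addrI /eqP; rewrite -subr_eq0 opprK -mulr2n mulrn_eq0 /=.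
by move/eqP=> ->; rewrite addr0 Crat_rat.
Qed.

Lemma quad_int_conj (x : K) : x \in O -> cj x \in O.
Proof. by rewrite !inE /= Aint_aut. Qed.

Lemma quad_int_real (x : K) : x \in O -> cj x = x -> exists z : int, x = z%:~R.
Proof.
move=> xO xr; have /intrP[z zE] : val x \in Num.int.
  exact: Cint_rat_Aint (quad_real_rat xr) xO.
by exists z; apply: val_inj; rewrite zE rmorph_int.
Qed.

Lemma quad_conj_real (x : K) : val x \is Num.real -> cj x = x.
Proof. by move/CrealP=> xr; apply: val_inj. Qed.

Lemma quad_int_nat (x : K) : x \in O -> 0 <= val x -> exists n, x = n%:R.
Proof.
move=> xO x0; have [z zE] := quad_int_real xO (quad_conj_real (ger0_real x0)).
exists `|z|%N; move: x0; rewrite zE rmorph_int ler0z => z0.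
by rewrite pmulrn gez0_abs.
Qed.

Lemma val_norm_ge0 (x : K) : 0 <= val (x * cj x).
Proof. by rewrite rmorphM /= mul_conjC_ge0. Qed.

Lemma val_norm_gt0 (x : K) : (0 < val (x * cj x)) = (x != 0).
Proof. by rewrite -val_eqE rmorph0 rmorphM /= mul_conjC_gt0. Qed.

Lemma quad_int_norm (x : K) : x \in O -> exists n, x * cj x = n%:R.
Proof.
move=> xO; apply: quad_int_nat (val_norm_ge0 x).
by rewrite rpredM ?quad_int_conj.
Qed.

Definition real_up_to c := forall (x : K) n,
  x \in O -> x * cj x = n%:R -> (n <= c)%N -> cj x = x.

(** With t the trace of x and d = - (x - cj x)^2, a non-real integer satisfies
    4 n = t^2 + d, and d = m k^2 with k a nonzero integer because m is
    square-free. Hence 4 n >= m; if m = 1 or 2 mod 4, reduction mod 4 makes k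
    even, and n >= m. *)
Lemma nonreal_norm_bound (x : K) n : squarefree m -> x \in O -> x * cj x = n%:R ->
  cj x != x -> (m <= 4 * n)%N /\ ((m %% 4 \in [:: 1; 2])%N -> (m <= n)%N).
Proof.
move=> sqf xO xn xN.
have [t tE] : exists t : int, x + cj x = t%:~R.
  apply: quad_int_real; first by rewrite rpredD ?quad_int_conj.
  by rewrite rmorphD /= quad_conjK addrC.
have [d dE] : exists d : int, - (x - cj x) ^+ 2 = d%:~R.
  apply: quad_int_real; first by rewrite rpredN rpredX // rpredB ?quad_int_conj.
  by rewrite rmorphN rmorphXn rmorphB /= quad_conjK -(opprB x) sqrrN.
have nE : 4 * n%:Z = t ^+ 2 + d.
  apply: (@intr_inj algC); rewrite rmorphD rmorphM rmorphXn /=.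
  have -> : (t%:~R : algC) = val (t%:~R : K) by rewrite rmorph_int.
  have -> : (d%:~R : algC) = val (d%:~R : K) by rewrite rmorph_int.
  rewrite -pmulrn -val_natr -xn -tE -dE.
  rewrite !(rmorphD, rmorphM, rmorphN, rmorphXn) /=. ring.
have [a [b [xE cE]]] := quadE x.
have dm : d%:~R = m%:R * (2 * b) ^+ 2 :> rat.
  apply: (@fmorph_inj _ _ (ratr : rat -> algC)).
  rewrite rmorph_int rmorphM rmorphXn rmorphM /= !rmorph_nat.
  have := congr1 val dE; rewrite rmorph_int => <-.
  have -> : val (- (x - cj x) ^+ 2) = - (val x - val (cj x)) ^+ 2.
    by rewrite rmorphN rmorphXn rmorphB.
  rewrite xE cE.
  have := val_quad_sqrt2.
  move: (val s) (ratr a) (ratr b) => S A B SS; ring: SS.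
have [k kE] := squarefree_sqr_int sqf dm.
have dk : d = m%:Z * k ^+ 2.
  by apply: (@intr_inj rat); rewrite dm kE rmorphM rmorphXn /= -pmulrn.
have k0 : k != 0.
  apply: contra xN => /eqP k0; move: kE; rewrite k0 => /eqP; rewrite mulf_eq0 /= => /eqP b0.
  by apply/eqP/val_inj; rewrite cE xE b0 rmorph0 !mul0r subr0 addr0.
have m1 : 0 < m%:Z by rewrite ltz_nat.
have k1 : 1 <= k ^+ 2 by nia.
split=> [|m4]; first by nia.
(* For m = 1, 2 mod 4 an odd k is impossible: t ^+ 2 + m * k ^+ 2 would be
   1, 2 or 3 mod 4. *)
have k2 : (k %% 2)%Z = 0.
  have [//|k1'] : (k %% 2)%Z = 0 \/ (k %% 2)%Z = 1 by lia.
  have t2 : (t %% 2)%Z = 0 \/ (t %% 2)%Z = 1 by lia.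
  have kq := divz_eq k 2; have tq := divz_eq t 2.
  have mm : exists q : int, m%:Z = 4 * q + 1 \/ m%:Z = 4 * q + 2.
    by exists (m %/ 4)%N; have := divn_eq m 4; move: m4; rewrite !inE; lia.
  case: t2 mm => t2 [q mm]; move: kq tq nE; rewrite dk t2 k1';
    move: (k %/ 2)%Z (t %/ 2)%Z => u v -> ->; case: mm => ->; lia.
have [j jE] : exists j, k = 2 * j by exists (k %/ 2)%Z; lia.
have j1 : 1 <= j ^+ 2 by nia.
by move: nE; rewrite dk jE; nia.
Qed.

Lemma quad_intP (x : K) (t n : int) :
  x + cj x = t%:~R -> x * cj x = n%:~R -> x \in O.
Proof.
move=> xt xn; rewrite inE.
pose p : {poly algC} := 'X ^+ 2 - t%:~R%:P * 'X + n%:~R%:P.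
have pE : p = Poly [:: n%:~R; - t%:~R; 1].
  by rewrite /= !cons_poly_def mul0r add0r /p polyCN; ring.
have ps : p = [:: n%:~R; - t%:~R; 1] :> seq algC.
  by rewrite pE (@PolyK _ 0) //= oner_eq0.
apply: (@root_monic_Aint p).
- have -> : p = ('X - (val x)%:P) * ('X - (val (cj x))%:P).
    rewrite /p; have -> : (t%:~R : algC) = val x + val (cj x) by rewrite -rmorphD xt rmorph_int.
    have -> : (n%:~R : algC) = val x * val (cj x) by rewrite -rmorphM xn rmorph_int.
    by rewrite polyCD polyCM; ring.
  by rewrite rootM root_XsubC eqxx.
- by rewrite monicE lead_coefE ps.
- apply/polyOverP=> i; rewrite ps.
  by case: i => [|[|[|i]]] /=; rewrite ?rpredN ?intr_int ?rpred1 ?nth_nil ?rpred0.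
Qed.

Lemma quad_sqrt_int : s \in O.
Proof.
apply: (@quad_intP _ 0 m%:Z); rewrite conj_quad_sqrt ?subrr //.
by rewrite mulrN quad_sqrt2 opprK -pmulrn.
Qed.

(** When m = 3 mod 4 this is the usual generator (1 + sqrt (- m)) / 2 of the
    ring of integers. *)
Definition quad_half : K := (1 + s) / 2%:R.
Local Notation w := quad_half.

Lemma quad_half_double : w * 2%:R = 1 + s.
Proof. by rewrite mulfVK // quad_natr_eq0. Qed.

Lemma conj_quad_half : cj w = 1 - w.
Proof.
apply: (mulIf (x := 2%:R)); first by rewrite quad_natr_eq0.
rewrite mulrBl quad_half_double -{1}(rmorph_nat cj) -rmorphM quad_half_double.
by rewrite rmorphD rmorph1 /= conj_quad_sqrt; ring.
Qed.

Lemma quad_half_norm k : (m + 1 = 4 * k)%N -> w * cj w = k%:R.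
Proof.
move=> mk; apply: (mulIf (x := 4%:R)); first by rewrite quad_natr_eq0.
rewrite conj_quad_half -natrM mulnC -mk natrD -[m%:R]opprK -quad_sqrt2.
have -> : s = w * 2%:R - 1 by rewrite quad_half_double addrC addKr.
by ring.
Qed.

Lemma quad_half_int k : (m + 1 = 4 * k)%N -> w \in O.
Proof.
move=> mk; apply: (@quad_intP _ 1 k%:Z); last by rewrite (quad_half_norm mk) -pmulrn.
by rewrite conj_quad_half; ring.
Qed.

Lemma conj_quad_half_neq : cj w != w.
Proof.
rewrite conj_quad_half; apply/eqP=> ww.
have := quad_half_double; rewrite mulr_natr mulr2n -{1}ww subrK => /esym/eqP.
by rewrite -subr_eq0 [1 + s]addrC addrK (negPf quad_sqrt_neq0).
Qed.

(** Being at distance at most 1/2 from an integer, in the squared form in which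
    the norm uses it. *)
Lemma rat_round (x : rat) : exists z : int, (x - z%:~R) ^+ 2 <= 1 / 4.
Proof.
exists (Num.floor (x + 1 / 2)); have := floor_itv (x + 1 / 2).
by rewrite intrD; nra.
Qed.

Lemma val_affine (i j : int) (z : K) : val (i%:~R + j%:~R * z) = i%:~R + j%:~R * val z.
Proof. by rewrite rmorphD rmorphM !rmorph_int. Qed.

Lemma conj_affine (i j : int) (z : K) : cj (i%:~R + j%:~R * z) = i%:~R + j%:~R * cj z.
Proof. by rewrite rmorphD rmorphM !rmorph_int. Qed.

(** Coordinatewise rounding. For m = 1, 2, on the basis 1, sqrt (- m), it leaves
    a norm of at most (1 + m) / 4 <= 3/4. For m = 3, 7, 11 the coefficient of
    sqrt (- m) is rounded to a half-integer first, and the norm is at most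
    1/4 + m/16 <= 15/16. *)
Lemma quad_euclid (x : K) : m \in [:: 1; 2; 3; 7; 11]%N ->
  exists2 q, q \in O & val ((x - q) * cj (x - q)) < 1.
Proof.
have [a [b [xE cE]]] := quadE x.
have norm (q : K) (c d : rat) : val q = ratr c + ratr d * val s ->
    val (cj q) = ratr c - ratr d * val s ->
    val ((x - q) * cj (x - q)) = ratr ((a - c) ^+ 2 + m%:R * (b - d) ^+ 2).
  move=> qE qcE.
  have -> : val ((x - q) * cj (x - q)) = (val x - val q) * (val (cj x) - val (cj q)).
    by rewrite rmorphM !rmorphB.
  have -> : ratr ((a - c) ^+ 2 + m%:R * (b - d) ^+ 2) =
      (ratr a - ratr c) ^+ 2 + m%:R * (ratr b - ratr d) ^+ 2 :> algC.
    by rewrite rmorphD rmorphM !rmorphXn !rmorphB rmorph_nat.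
  rewrite xE cE qE qcE; have := val_quad_sqrt2.
  by move: (val s) (ratr a) (ratr b) (ratr c) (ratr d) => S A B C D SS; ring: SS.
move=> mm.
have [m4|[k mk]] : m \in [:: 1; 2]%N \/ exists k, (m + 1 = 4 * k)%N.
  by move: mm; rewrite !inE => /or4P[/eqP->|/eqP->|/eqP->|/orP[]/eqP->];
     [left|left|right; exists 1%N|right; exists 2%N|right; exists 3%N].
- have [i ia] := rat_round a; have [j jb] := rat_round b.
  exists (i%:~R + j%:~R * s); first by rewrite rpredD ?rpredM ?rpred_int ?quad_sqrt_int.
  rewrite (norm _ i%:~R j%:~R).
  + rewrite -(rmorph1 (ratr : rat -> algC)) ltr_rat.
    have : m%:R <= 2 :> rat by move: m4; rewrite !inE => /orP[]/eqP->.
    have v0 := sqr_ge0 (b - j%:~R); have := ler0n rat m.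
    move: (m%:R : rat) (_ ^+ 2) (_ ^+ 2) ia jb v0 => M u v; nra.
  + by rewrite val_affine !rmorph_int.
  + by rewrite conj_affine val_affine conj_quad_sqrt rmorphN mulrN !rmorph_int.
(* Here the approximation is i + j * w, so j is taken close to twice the second
   coordinate, and i makes up for the real part j / 2 of j * w. *)
- have [j jb] := rat_round (2 * b); have [i ia] := rat_round (a - j%:~R / 2).
  have wV : val w = ratr (1 / 2) + ratr (1 / 2) * val s.
    rewrite /w fmorph_div rmorphD rmorph1 rmorph_nat fmorph_div rmorph1 rmorph_nat.
    by rewrite mulrDl; congr (_ + _); rewrite mul1r mulrC.
  exists (i%:~R + j%:~R * w).
    apply: rpredD; first exact: rpred_int.
    by apply: rpredM; [exact: rpred_int | exact: quad_half_int mk].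
  have qV : val (i%:~R + j%:~R * w) = ratr (i%:~R + j%:~R / 2) + ratr (j%:~R / 2) * val s.
    rewrite val_affine wV !(fmorph_div, rmorphD, rmorph1, rmorph_nat, rmorph_int).
    by rewrite mul1r mulrDr mulrA addrA.
  have qcV : val (cj (i%:~R + j%:~R * w)) = ratr (i%:~R + j%:~R / 2) - ratr (j%:~R / 2) * val s.
    have -> : val (cj (i%:~R + j%:~R * w)) = i%:~R + j%:~R * (1 - val w).
      by rewrite conj_affine val_affine conj_quad_half rmorphB rmorph1.
    rewrite wV !(fmorph_div, rmorphD, rmorph1, rmorph_nat, rmorph_int).
    by field.
  rewrite (norm _ _ _ qV qcV) -(rmorph1 (ratr : rat -> algC)) ltr_rat.
  have mR : m%:R <= 11 :> rat.
    by move: mm; rewrite !inE => /or4P[/eqP->|/eqP->|/eqP->|/orP[]/eqP->].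
  have m0 := ler0n rat m.
  have -> : a - (i%:~R + j%:~R / 2) = a - j%:~R / 2 - i%:~R by ring.
  have v0 := sqr_ge0 (b - j%:~R / 2).
  have vb : (b - j%:~R / 2) ^+ 2 <= 1 / 16 by lra.
  have Mv : m%:R * (b - j%:~R / 2) ^+ 2 <= 11 * (1 / 16) by apply: ler_pM.
  by lra.
Qed.

End QuadraticField.

(** * Lattices in diagonal Hermitian spaces *)

Section Span.
Variables (m : nat) (V : vectType (quad m)).
Implicit Types (s : seq V) (x y : V).

Lemma in_span_gen s x : x \in s -> in_span s x.
Proof.
move=> xs; have ix : (index x s < size s)%N by rewrite index_mem.
exists (fun i => (i == Ordinal ix)%:R) => [i|]; first by rewrite rpred_nat.
rewrite (bigD1 (Ordinal ix)) //= eqxx scale1r nth_index // big1 ?addr0 // => i /negPf ->.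
by rewrite scale0r.
Qed.

Lemma in_span0 s : in_span s 0.
Proof.
exists (fun=> 0) => [i|]; first by rewrite rpred0.
by rewrite big1 // => i _; rewrite scale0r.
Qed.

Lemma in_spanD s x y : in_span s x -> in_span s y -> in_span s (x + y).
Proof.
move=> [c cO ->] [d dO ->]; exists (fun i => c i + d i) => [i|]; first by rewrite rpredD.
by rewrite -big_split; apply: eq_bigr => i _; rewrite scalerDl.
Qed.

Lemma in_spanZ s a x : a \in quad_int m -> in_span s x -> in_span s (a *: x).
Proof.
move=> aO [c cO ->]; exists (fun i => a * c i) => [i|]; first by rewrite rpredM.
by rewrite scaler_sumr; apply: eq_bigr => i _; rewrite scalerA.
Qed.

Lemma in_spanB s x y : in_span s x -> in_span s y -> in_span s (x - y).
Proof.
by move=> xs ys; rewrite -scaleN1r; apply/in_spanD/in_spanZ => //; rewrite rpredN rpred1.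
Qed.

Lemma in_span_sum s n (F : 'I_n -> V) :
  (forall i, in_span s (F i)) -> in_span s (\sum_i F i).
Proof. by move=> Fs; apply: big_ind => //; [apply: in_span0 | apply: in_spanD]. Qed.

Lemma in_span_span s x : in_span s x -> x \in <<s>>%VS.
Proof.
move=> [c _ ->]; apply: rpred_sum => i _; apply: rpredZ.
by apply: memv_span; apply: mem_nth.
Qed.

End Span.

Section DiagonalForm.
Variables (m n : nat).
Local Notation K := (quad m).
Local Notation cj := (@quad_conj m).
Local Notation V := 'rV[K]_n.
Variable d : 'I_n -> nat.

(** Integral weights suffice: all the binary lattices below embed in a diagonal
    space of this kind once their generators may have fractional coordinates. *)
Definition diag_form (u v : V) : K := \sum_i (d i)%:R * (u 0 i * cj (v 0 i)).

Fact diag_form_additivel v : zmod_morphism (diag_form ^~ v).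
Proof.
move=> x y; rewrite /diag_form -sumrB; apply: eq_bigr => i _.
by rewrite !mxE mulrBl mulrBr.
Qed.

Fact diag_form_additiver u : zmod_morphism (diag_form u).
Proof.
move=> x y; rewrite /diag_form -sumrB; apply: eq_bigr => i _.
by rewrite !mxE rmorphB !mulrBr.
Qed.

Fact diag_form_scalablel v : scalable_for *%R (diag_form ^~ v).
Proof.
move=> a x; rewrite /diag_form mulr_sumr; apply: eq_bigr => i _.
by rewrite !mxE /= -mulrA mulrCA.
Qed.

Fact diag_form_scalabler u : scalable_for (cj \; *%R) (diag_form u).
Proof.
move=> a x; rewrite /diag_form /= mulr_sumr; apply: eq_bigr => i _.
by rewrite !mxE /= rmorphM /=; ring.
Qed.

Fact diag_form_hermitian u v : diag_form u v = (-1) ^+ false * cj (diag_form v u).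
Proof.
rewrite expr0 mul1r rmorph_sum; apply: eq_bigr => i _.
by rewrite !rmorphM rmorph_nat /= quad_conjK [u 0 i * _]mulrC.
Qed.

HB.instance Definition _ := isBilinear.Build K V V K *%R (cj \; *%R) diag_form
  diag_form_additivel diag_form_additiver diag_form_scalablel diag_form_scalabler.
HB.instance Definition _ :=
  isHermitianSesquilinear.Build K V false cj diag_form diag_form_hermitian.

End DiagonalForm.

Section HermitianForm.
Variables (m : nat) (V : vectType (quad m)).
Local Notation cj := (@quad_conj m).
Variable H : {hermitian V for false & cj}.

Lemma hermitianC x y : H x y = cj (H y x).
Proof. by rewrite hermitian_subproof expr0 mul1r. Qed.

Lemma hermitian_eq0C x y : H x y = 0 -> H y x = 0.
Proof. by move=> xy; rewrite hermitianC xy; apply: rmorph0. Qed.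

Lemma hermDl x y z : H (x + y) z = H x z + H y z.
Proof. exact: linearDl. Qed.

Lemma hermBl x y z : H (x - y) z = H x z - H y z.
Proof. exact: linearBl. Qed.

Lemma hermZl a x z : H (a *: x) z = a * H x z.
Proof. exact: linearZl_LR. Qed.

Lemma hermDr x y z : H z (x + y) = H z x + H z y.
Proof. exact: linearDr. Qed.

Lemma hermBr x y z : H z (x - y) = H z x - H z y.
Proof. exact: linearBr. Qed.

Lemma hermZr a x z : H z (a *: x) = cj a * H z x.
Proof. exact: linearZr_LR. Qed.

Lemma herm_suml I r (P : pred I) (F : I -> V) z :
  H (\sum_(i <- r | P i) F i) z = \sum_(i <- r | P i) H (F i) z.
Proof. exact: linear_sumlz. Qed.

Lemma herm_sumr I r (P : pred I) (F : I -> V) z :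
  H z (\sum_(i <- r | P i) F i) = \sum_(i <- r | P i) H z (F i).
Proof. exact: linear_sumr. Qed.

Lemma herm_int_span (s : seq V) :
  (forall x y, x \in s -> y \in s -> H x y \in quad_int m) ->
  forall x y, in_span s x -> in_span s y -> H x y \in quad_int m.
Proof.
move=> sO x y [c cO ->] [e eO ->].
rewrite herm_suml; apply: rpred_sum => i _.
rewrite herm_sumr; apply: rpred_sum => j _.
rewrite hermZl hermZr /= !rpredM ?quad_int_conj //.
by apply: sO; apply: mem_nth.
Qed.

Lemma herm_span_orthogonal (s : seq V) v :
  (forall x, x \in s -> H x v = 0) -> forall y, y \in <<s>>%VS -> H y v = 0.
Proof.
move=> sv y /(@coord_span _ _ _ (in_tuple s)) ->; rewrite herm_suml big1 // => i _.
by rewrite hermZl sv ?mulr0 //; apply: mem_nth.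
Qed.

Lemma free_cons_orthogonal (s : seq V) v :
  H v v != 0 -> (forall x, x \in s -> H x v = 0) -> free s -> free (v :: s).
Proof.
move=> vv sv fs; rewrite free_cons fs andbT; apply: contra vv => vs.
by rewrite (herm_span_orthogonal sv vs).
Qed.

End HermitianForm.

(** The matrix form of a representation, read back as a choice of images: row i
    of X holds the coordinates of the image of the i-th generator. *)
Lemma represents_vectors (m : nat) (L l : lattice m) : represents L l ->
  exists2 f : lspace l -> lspace L,
    forall x, x \in lgens l -> lmem (f x) &
    forall x y, x \in lgens l -> y \in lgens l -> lform L (f x) (f y) = lform l x y.
Proof.
move=> [X XO XE].
pose F i := \sum_j X i j *: (lgens L)`_j.
pose f x := oapp F 0 (insub (index x (lgens l))).
have fE x (xl : x \in lgens l) :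
    exists2 i : 'I_(size (lgens l)), f x = F i & (lgens l)`_i = x.
  have ix : (index x (lgens l) < size (lgens l))%N by rewrite index_mem.
  by exists (Ordinal ix); [rewrite /f insubT | rewrite /= nth_index].
exists f => [x /fE[i -> _]|x y /fE[i -> <-] /fE[j -> <-]].
  apply: in_span_sum => j; apply: in_spanZ; first exact: (mxOverP XO).
  by apply: in_span_gen; apply: mem_nth.
have /matrixP/(_ i j) := XE; rewrite [LHS]mxE => ->; rewrite mxE herm_sumr.
apply: eq_bigr => k _; rewrite hermZr /= mulrC !mxE herm_suml.
by congr (_ * _); apply: eq_bigr => h _; rewrite hermZl mxE.
Qed.

Section BinaryDiagonal.
Variable m : nat.
Local Notation K := (quad m).
Local Notation cj := (@quad_conj m).
Local Notation V := 'rV[K]_2.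

Definition row2 (a b : K) : V := \row_j (if j == 0 then a else b).
Definition weight2 (p q : nat) (i : 'I_2) : nat := if i == 0 then p else q.

Lemma diag_form2 p q a b a' b' :
  diag_form (weight2 p q) (row2 a b) (row2 a' b') =
  p%:R * (a * cj a') + q%:R * (b * cj b').
Proof. by rewrite /diag_form !big_ord_recl big_ord0 !mxE /= addr0. Qed.

Lemma diag_form_gt0 n (d : 'I_n -> nat) (v : 'rV[K]_n) :
  (forall i, 0 < d i)%N -> v != 0 -> 0 < val (diag_form d v v).
Proof.
move=> d0 /rV0Pn[i vi].
have -> : val (diag_form d v v) = \sum_j (d j)%:R * val (v 0 j * cj (v 0 j)).
  by rewrite raddf_sum; apply: eq_bigr => j _; rewrite rmorphM; congr (_ * _); exact: val_natr.
rewrite (bigD1 i) //= ltr_pwDl //; first by rewrite mulr_gt0 ?ltr0n // val_norm_gt0.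
by apply: sumr_ge0 => j _; rewrite mulr_ge0 ?ler0n // val_norm_ge0.
Qed.

(** The only access to 2-universality used below: vectors of a diagonal plane
    with integral products have copies in L with the same products. The two
    named vectors of g make the rank equal to 2. *)
Lemma two_universal_diag (L : lattice m) p q (g : seq V) b : two_universal L ->
  (0 < p)%N -> (0 < q)%N -> row2 1 0 \in g -> (exists2 c, c != 0 & row2 b c \in g) ->
  (forall x y, x \in g -> y \in g -> diag_form (weight2 p q) x y \in quad_int m) ->
  exists2 f : V -> lspace L, forall x, x \in g -> lmem (f x) &
    forall x y, x \in g -> y \in g -> lform L (f x) (f y) = diag_form (weight2 p q) x y.
Proof.
move=> [_ uL] p0 q0 g1 [c c0 g2] gO.
pose l := @Lattice m V (diag_form (weight2 p q) : {hermitian V for false & cj}) g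
  (herm_int_span (H := diag_form (weight2 p q)) gO).
have := @represents_vectors m L l; apply; apply: uL.
  have -> : 2%N = \dim (fullv : {vspace V}) by rewrite dimvf /dim /= mul1n.
  congr (\dim _); apply/vspaceP=> v; rewrite memvf.
  have -> : v = (v 0 0 - v 0 1 / c * b) *: row2 1 0 + (v 0 1 / c) *: row2 b c.
    apply/rowP=> i; rewrite !mxE.
    have [->|->] : i = 0 \/ i = 1 by case: i => -[|[|]] // ?; [left|right]; apply: val_inj.
      by rewrite /=; ring.
    by rewrite /= mulr0 add0r divfK.
  by rewrite rpredD // rpredZ // memv_span.
move=> v _ v0; apply: diag_form_gt0 v0 => i.
by rewrite /weight2; case: ifP.
Qed.

End BinaryDiagonal.

(** * A ternary lattice containing an orthonormal pair *)

Section TernaryLattice.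
Variables (m : nat) (m_gt0 : (0 < m)%N) (L : lattice m).
Hypotheses (L3 : lrank L = 3%N) (Lpos : positive L).
Local Notation K := (quad m).
Local Notation O := (quad_int m).
Local Notation cj := (@quad_conj m).
Local Notation H := (lform L).

Variables e1 e2 : lspace L.
Hypotheses (e1L : lmem e1) (e2L : lmem e2).
Hypotheses (e11 : H e1 e1 = 1) (e22 : H e2 e2 = 1) (e12 : H e1 e2 = 0).

Let e21 : H e2 e1 = 0.
Proof. exact: hermitian_eq0C. Qed.

Lemma lform_nat v : lmem v -> exists n, H v v = n%:R.
Proof.
move=> vL; apply: quad_int_nat => //; first by apply: lform_int.
have [->|v0] := eqVneq v 0; last exact: ltW (Lpos vL v0).
by have -> : H 0 0 = 0 by exact: linear0l.
Qed.

Lemma lform_neq0 v : lmem v -> v != 0 -> H v v != 0.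
Proof.
by move=> vL v0; rewrite -val_eqE rmorph0 gt_eqF // Lpos.
Qed.

Definition complement v := [/\ lmem v, H v e1 = 0 & H v e2 = 0].

Lemma complementZ a v : a \in O -> complement v -> complement (a *: v).
Proof. by move=> aO [vL v1 v2]; split; rewrite ?hermZl ?v1 ?v2 ?mulr0 //; apply: in_spanZ. Qed.

Lemma complementB v w : complement v -> complement w -> complement (v - w).
Proof.
by move=> [vL v1 v2] [wL w1 w2]; split; rewrite ?hermBl ?v1 ?v2 ?w1 ?w2 ?subrr //; apply: in_spanB.
Qed.

Lemma free_complement z : complement z -> z != 0 -> free [:: z; e1; e2].
Proof.
move=> [zL z1 z2] z0.
apply: (@free_cons_orthogonal _ _ H); first exact: lform_neq0.
  by move=> x; rewrite !inE => /orP[]/eqP->; apply: hermitian_eq0C.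
apply: (@free_cons_orthogonal _ _ H); first by rewrite e11 oner_eq0.
  by move=> x; rewrite inE => /eqP->.
apply: (@free_cons_orthogonal _ _ H); first by rewrite e22 oner_eq0.
  by [].
exact: nil_free.
Qed.

(** Otherwise u, z, e1, e2 would be four independent vectors in a space of
    dimension 3. *)
Lemma complement_orthogonal z u :
  complement z -> complement u -> z != 0 -> H z u = 0 -> u = 0.
Proof.
move=> zC uC z0 zu; apply/eqP/negPn/negP => u0; have [uL u1 u2] := uC; have [zL _ _] := zC.
have fr : free [:: u; z; e1; e2].
  apply: (@free_cons_orthogonal _ _ H); first exact: lform_neq0.
    move=> x; rewrite !inE => /or3P[]/eqP->; rewrite ?zu //; exact: hermitian_eq0C.
  exact: free_complement.
have : (\dim <<[:: u; z; e1; e2]>> <= lrank L)%N.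
  apply/dimvS/span_subvP => x; rewrite !inE => /or4P[]/eqP->; exact: in_span_span.
by move/eqP: fr => ->; rewrite L3.
Qed.

(** The two sides differ by a vector of the complement that is orthogonal to z;
    stating collinearity without division keeps that vector inside L. *)
Lemma complement_collinear z w : complement z -> complement w -> H z z *: w = H w z *: z.
Proof.
move=> zC wC; have [->|z0] := eqVneq z 0.
  have -> : H 0 0 = 0 by exact: linear0l.
  by rewrite scale0r scaler0.
have zzO : H z z \in O by case: zC => zL _ _; apply: lform_int.
have wzO : H w z \in O by case: zC wC => zL _ _ [wL _ _]; apply: lform_int.
apply/eqP; rewrite -subr_eq0; apply/eqP.
apply: (complement_orthogonal zC) => //; first by apply: complementB; apply: complementZ.
rewrite hermBr !hermZr -!(hermitianC H); ring.
Qed.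

(** The complement has rank one, so Cauchy-Schwarz is an equality there. *)
Lemma complement_norm z w : complement z -> complement w ->
  H z w * cj (H z w) = H z z * H w w.
Proof.
move=> zC wC; have /(congr1 (H w)) := complement_collinear zC wC.
rewrite !hermZr -!(hermitianC H) => ->; ring.
Qed.

(** Since e1 and e2 have norm 1, the projection off their span stays in L. *)
Definition perp v := v - H v e1 *: e1 - H v e2 *: e2.

Lemma perp_complement v : lmem v -> complement (perp v).
Proof.
move=> vL; split; rewrite /perp.
- by apply: in_spanB; [apply: in_spanB => //|]; apply: in_spanZ => //; apply: lform_int.
- by rewrite !hermBl !hermZl e11 e21; ring.
- by rewrite !hermBl !hermZl e22 e12; ring.
Qed.

Lemma perpK v : v = H v e1 *: e1 + H v e2 *: e2 + perp v.
Proof. by rewrite /perp -[v - _ - _]addrA -opprD [RHS]addrC subrK. Qed.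

Lemma lform_perp v w : lmem v -> lmem w ->
  H v w = H v e1 * cj (H w e1) + H v e2 * cj (H w e2) + H (perp v) (perp w).
Proof.
move=> vL wL; have [_ v1 v2] := perp_complement vL; have [_ w1 w2] := perp_complement wL.
have := perpK w; have := perpK v.
move: (perp v) (perp w) v1 v2 w1 w2 => z u z1 z2 u1 u2 vE wE.
rewrite {1}vE {1}wE !hermDl !hermDr !hermZl !hermZr.
rewrite z1 z2 (hermitian_eq0C u1) (hermitian_eq0C u2) e11 e12 e21 e22.
ring.
Qed.

(** Write 2 = a + b + h and c = a' + b' + h', the last terms being the norms of
    the components of v and w in the complement. If h <= 1, then H v w is a sum
    of products of integers of norm at most c (the product of the components
    has norm h h'), so it is real. Hence h = 2, and a = b = 0. *)
Lemma two_in_complement v w c : (2 <= c)%N -> real_up_to m c ->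
  lmem v -> lmem w -> H v v = 2%:R -> H w w = c%:R -> cj (H v w) != H v w -> complement v.
Proof.
move=> c2 small vL wL vv ww vwN.
have [zC z'C] := (perp_complement vL, perp_complement wL).
have [[zL _ _] [z'L _ _]] := (zC, z'C).
have O1 u : lmem u -> H u e1 \in O by move=> uL; apply: lform_int.
have O2 u : lmem u -> H u e2 \in O by move=> uL; apply: lform_int.
have [a aE] := quad_int_norm m_gt0 (O1 v vL).
have [b bE] := quad_int_norm m_gt0 (O2 v vL).
have [a' a'E] := quad_int_norm m_gt0 (O1 w wL).
have [b' b'E] := quad_int_norm m_gt0 (O2 w wL).
have [h hE] := lform_nat zL; have [h' h'E] := lform_nat z'L.
have abh : (a + b + h = 2)%N.
  apply: (@quad_natr_inj m); rewrite !natrD -aE -bE -hE -vv; exact/esym/lform_perp.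
have abh' : (a' + b' + h' = c)%N.
  apply: (@quad_natr_inj m); rewrite !natrD -a'E -b'E -h'E -ww; exact/esym/lform_perp.
have [h1|h1] := leqP h 1.
  case/eqP: vwN; rewrite lform_perp // !rmorphD !rmorphM /= !quad_conjK.
  rewrite (small _ _ (O1 v vL) aE) ?(small _ _ (O2 v vL) bE); try lia.
  rewrite (small _ _ (O1 w wL) a'E) ?(small _ _ (O2 w wL) b'E); try lia.
  congr (_ + _); apply: (small _ (h * h')%N).
  - by apply: lform_int.
  - by rewrite complement_norm // hE h'E natrM.
  - nia.
have [a0 b0] : a = 0%N /\ b = 0%N by lia.
have cj0 x : x * cj x = 0%:R -> x = 0 by move/eqP; rewrite mulf_eq0 fmorph_eq0 orbb => /eqP.
by split=> //; apply: cj0; [rewrite aE a0 | rewrite bE b0].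
Qed.

Lemma complement_nontrivial : exists2 z, complement z & z != 0.
Proof.
have [/hasP[g gL g0]|/hasPn gens0] := boolP (has (fun g => perp g != 0) (lgens L)).
  by exists (perp g) => //; apply/perp_complement/in_span_gen.
have : (lrank L <= \dim <<[:: e1; e2]>>)%N.
  apply/dimvS/span_subvP => g /gens0; rewrite negbK => /eqP g0.
  by rewrite (perpK g) g0 addr0 rpredD // rpredZ // memv_span // !inE eqxx ?orbT.
by rewrite L3 leqNgt ltnS dim_span.
Qed.

(** By Euclidean division a vector z of least positive norm in the complement
    generates it: the remainder of w by z has smaller norm than z, hence
    vanishes. Then z, e1, e2 is a basis. *)
Lemma euclidean_free :
  (forall x : K, exists2 q, q \in O & val ((x - q) * cj (x - q)) < 1) -> is_free L.
Proof.
move=> euclid.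
have [z [zC z0 zgen]] : exists z, [/\ complement z, z != 0 &
    forall w, complement w -> exists2 q, q \in O & w = q *: z].
  have [z zC z0] := complement_nontrivial; have [zL _ _] := zC.
  have [n] := lform_nat zL; elim/ltn_ind: n z zC z0 zL => n IHn z zC z0 zL zn.
  case: (classic (forall w, complement w -> exists2 q, q \in O & w = q *: z)) => [|zN].
    by exists z.
  have [w wN] := not_all_ex_not _ _ zN.
  have [wC {}wN] := imply_to_and _ _ wN.
  have zz := lform_neq0 zL z0.
  have [q qO qN] := euclid (H w z / H z z).
  have w'C : complement (w - q *: z) by apply: complementB => //; apply: complementZ.
  have [w'L _ _] := w'C.
  have [k kE] := lform_nat w'L.
  have wE : w - q *: z = (H w z / H z z - q) *: z.
    rewrite scalerBl; congr (_ - _); apply: (scalerI zz).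
    by rewrite complement_collinear // scalerA mulrCA divff // mulr1.
  apply: (IHn k _ (w - q *: z)) => //.
    have n0 : 0 < (n%:R : algC).
      have := Lpos zL z0; rewrite zn; suff -> : val (n%:R : K) = n%:R by [].
      exact: val_natr.
    have kn : k%:R = val ((H w z / H z z - q) * cj (H w z / H z z - q)) * n%:R.
      by rewrite -(val_natr m k) -(val_natr m n) -rmorphM -kE wE hermZl hermZr mulrA zn.
    by rewrite -(@ltr_nat algC) kn -[ltRHS]mul1r ltr_pM2r.
  by apply/eqP=> w0; apply: wN; exists q => //; apply/eqP; rewrite -subr_eq0 w0.
have [zL _ _] := zC.
exists [:: z; e1; e2] => [x|c _ c0].
  split=> [xL|[c cO ->]].
    have [q qO qE] := zgen _ (perp_complement xL).
    rewrite (perpK x) qE; apply: in_spanD; first apply: in_spanD.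
    - by apply: in_spanZ; [apply: lform_int | apply: in_span_gen; rewrite !inE eqxx orbT].
    - by apply: in_spanZ; [apply: lform_int | apply: in_span_gen; rewrite !inE eqxx !orbT].
    - by apply: in_spanZ => //; apply: in_span_gen; rewrite inE eqxx.
  apply: in_span_sum => i; apply: in_spanZ => //.
  by have := mem_nth 0 (ltn_ord i); rewrite !inE => /or3P[]/eqP->.
by apply: (@freeP _ _ _ [tuple z; e1; e2]) c0; apply: free_complement.
Qed.

End TernaryLattice.

(** * Planes that a ternary lattice cannot represent *)

Section TwoUniversalTernary.
Variables (m : nat) (m_gt0 : (0 < m)%N) (L : lattice m).
Hypotheses (L3 : lrank L = 3%N) (Lu : two_universal L).
Local Notation K := (quad m).
Local Notation O := (quad_int m).
Local Notation cj := (@quad_conj m).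
Local Notation H := (lform L).

Let Lpos : positive L := Lu.1.

Lemma orthonormal_pair : exists e : lspace L * lspace L,
  [/\ lmem e.1, lmem e.2, H e.1 e.1 = 1, H e.2 e.2 = 1 & H e.1 e.2 = 0].
Proof.
have := two_universal_diag (p := 1) (q := 1) (g := [:: row2 1 0; row2 0 1]) (b := 0) Lu.
case=> //; first by rewrite inE eqxx.
- by exists 1; [exact: oner_neq0 | rewrite !inE eqxx orbT].
- move=> x y; rewrite !in_cons !in_nil !orbF => /orP[]/eqP-> /orP[]/eqP->; rewrite diag_form2;
    by rewrite ?(rmorph0, rmorph1) ?rpredD ?rpredM ?rpred0 ?rpred1 ?rpred_nat.
move=> f fL fH.
have g1 : row2 1 0 \in [:: row2 1 0; row2 0 1 : 'rV[K]_2] by rewrite inE eqxx.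
have g2 : row2 0 1 \in [:: row2 1 0; row2 0 1 : 'rV[K]_2] by rewrite !inE eqxx orbT.
exists (f (row2 1 0), f (row2 0 1)); split; rewrite /=; [exact: fL | exact: fL | | | ];
  by rewrite fH // diag_form2 ?(rmorph0 cj) ?(rmorph1 cj); ring.
Qed.

Let two0 : (2%:R : K) != 0. Proof. by rewrite quad_natr_eq0. Qed.

(** The plane with Gram matrix [2, b; cj b, c] is not represented. Its first
    vector would have to lie in the complement of the orthonormal pair, where
    b depends only on the component of the second vector, of norm h say; the
    equality case of Cauchy-Schwarz gives n = 2 h, but n is odd. *)
Lemma no_odd_entry (b : K) n c : b \in O -> cj b != b -> b * cj b = n%:R -> odd n ->
  (n < 2 * c)%N -> (2 <= c)%N -> real_up_to m c -> False.
Proof.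
move=> bO bN bn n_odd nc c2 small.
(* Gram-Schmidt on the Gram matrix [2, b; cj b, c] gives the coordinate cj b / 2
   and the remaining norm (2 c - n) / 2, that is q times the norm of 1/2. *)
pose t := cj b / 2%:R; pose q := (2 * (2 * c - n))%N.
pose g := [:: row2 1 0; row2 t (2%:R)^-1 : 'rV[K]_2].
have ct : cj t = b / 2%:R by rewrite /t rmorphM fmorphV rmorph_nat /= quad_conjK.
have ch : cj (2%:R)^-1 = (2%:R)^-1 by rewrite fmorphV rmorph_nat.
have E11 : diag_form (weight2 2 q) (row2 1 0) (row2 1 0 : 'rV[K]_2) = 2%:R.
  by rewrite diag_form2 rmorph0 rmorph1; ring.
have E12 : diag_form (weight2 2 q) (row2 1 0) (row2 t (2%:R)^-1) = b.
  by rewrite diag_form2 ct; field.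
have E21 : diag_form (weight2 2 q) (row2 t (2%:R)^-1) (row2 1 0) = cj b.
  by rewrite diag_form2 /t rmorph0 rmorph1; field.
have E22 : diag_form (weight2 2 q) (row2 t (2%:R)^-1) (row2 t (2%:R)^-1) = c%:R.
  rewrite diag_form2 ct ch /t.
  have -> : 2%:R * (cj b / 2%:R * (b / 2%:R)) = n%:R / 2%:R by rewrite -bn; field.
  have -> : q%:R = 2%:R * (2%:R * c%:R - n%:R) :> K.
    by rewrite /q natrM natrB ?natrM // ltnW.
  by field.
have g1 : row2 1 0 \in g by rewrite inE eqxx.
have g2 : row2 t (2%:R)^-1 \in g by rewrite !inE eqxx orbT.
have [|||||f fL fH] := two_universal_diag (p := 2) (q := q) (g := g) (b := t) Lu => //.
- by rewrite /q; lia.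
- by exists (2%:R)^-1; rewrite // invr_eq0.
- move=> x y; rewrite !in_cons !in_nil !orbF => /orP[]/eqP-> /orP[]/eqP->;
    rewrite ?(E11, E12, E21, E22); by rewrite ?rpred_nat ?quad_int_conj.
have [[e1 e2] /= [e1L e2L e11 e22 e12]] := orthonormal_pair.
set v := row2 1 0 in g1 E11 E12; set w := row2 t _ in g2 E12 E22.
have [vL wL] := (fL _ g1, fL _ g2).
have vC : complement e1 e2 (f v).
  apply: (two_in_complement m_gt0 L3 Lpos e1L e2L e11 e22 e12 c2 small vL wL).
  - by rewrite fH.
  - by rewrite fH.
  - by rewrite fH ?E12.
have wC := perp_complement e1L e2L e11 e22 e12 wL.
have [wpL _ _] := wC; have [h hE] := lform_nat m_gt0 Lpos wpL.
have bE : H (f v) (perp e1 e2 (f w)) = b.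
  rewrite -E12 -fH // (lform_perp e1L e2L e11 e22 e12 vL wL).
  have [_ v1 v2] := vC; rewrite v1 v2 !mul0r !add0r.
  by rewrite {2}/perp v1 v2 !scale0r !subr0.
have := complement_norm L3 Lpos e1L e2L e11 e22 e12 vC wC.
rewrite bE bn fH // E11 hE -natrM => /quad_natr_inj nE.
by move: n_odd; rewrite nE mul2n odd_double.
Qed.

(** Take two orthogonal copies of the rank one lattice with formal Gram matrix
    [2, b; cj b, c], of determinant 0. In each copy the vector of norm 2 would
    lie in the complement of the orthonormal pair; these two vectors are
    orthogonal and nonzero, but the complement has rank one. *)
Lemma no_even_entry (b : K) c : b \in O -> cj b != b -> b * cj b = (2 * c)%:R ->
  (2 <= c)%N -> real_up_to m c -> False.
Proof.
move=> bO bN bn c2 small.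
pose t := cj b / 2%:R.
pose g := [:: row2 1 0; row2 t 0; row2 0 1; row2 0 t : 'rV[K]_2].
have ct : cj t = b / 2%:R by rewrite /t rmorphM fmorphV rmorph_nat /= quad_conjK.
pose D := diag_form (weight2 2 2) : 'rV[K]_2 -> 'rV[K]_2 -> K.
have DE x y x' y' : D (row2 x y) (row2 x' y') = 2%:R * (x * cj x') + 2%:R * (y * cj y').
  exact: diag_form2.
have t2 : 2%:R * t = cj b by rewrite /t; field.
have ct2 : 2%:R * cj t = b by rewrite ct; field.
have tt2 : 2%:R * (t * cj t) = c%:R.
  have -> : 2%:R * (t * cj t) = b * cj b / 2%:R by rewrite ct /t; field.
  by rewrite bn natrM; field.
have [g1 g2 g3 g4] :
    [/\ row2 1 0 \in g, row2 t 0 \in g, row2 0 1 \in g & row2 0 t \in g].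
  by rewrite !inE !eqxx !orbT.
have [|||||f fL fH] := two_universal_diag (p := 2) (q := 2) (g := g) (b := 0) Lu => //.
- by exists 1; rewrite ?oner_eq0.
- move=> x y; rewrite !in_cons !in_nil !orbF => /or4P[]/eqP-> /or4P[]/eqP->; rewrite diag_form2;
    rewrite ?(rmorph0, rmorph1) !(mulr0, mul0r, mulr1, mul1r, addr0, add0r);
    by rewrite ?t2 ?ct2 ?tt2 ?rpred0 ?rpred_nat ?quad_int_conj.
have [[e1 e2] /= [e1L e2L e11 e22 e12]] := orthonormal_pair.
have vwC v w : v \in g -> w \in g -> D v v = 2%:R -> D w w = c%:R -> D v w = b ->
    complement e1 e2 (f v).
  move=> vg wg vv ww vw.
  apply: (two_in_complement m_gt0 L3 Lpos e1L e2L e11 e22 e12 c2 small (fL _ vg) (fL _ wg)).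
  - by rewrite fH.
  - by rewrite fH.
  - by rewrite fH // [diag_form _ _ _]vw.
have simp := (rmorph0 cj, rmorph1 cj, mulr0, mul0r, mulr1, mul1r, addr0, add0r).
have C1 : complement e1 e2 (f (row2 1 0)).
  by apply: (vwC _ (row2 t 0)); rewrite ?DE ?simp.
have C2 : complement e1 e2 (f (row2 0 1)).
  by apply: (vwC _ (row2 0 t)); rewrite ?DE ?simp.
have := complement_norm L3 Lpos e1L e2L e11 e22 e12 C1 C2.
rewrite !fH // -/D !DE !simp => /eqP.
by rewrite eq_sym mulf_eq0 (negPf two0).
Qed.

End TwoUniversalTernary.

(** * A plane for each residue class of m *)

Theorem theorem1 (m : nat) (m_gt0 : (0 < m)%N) (m_sqf : squarefree m) :
  (m \notin [:: 1; 2; 3; 7; 11]%N ->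
     ~ exists L : lattice m, lrank L = 3%N /\ two_universal L) /\
  (forall L : lattice m, lrank L = 3%N -> two_universal L -> is_free L).
Proof.
have nonexistence : m \notin [:: 1; 2; 3; 7; 11]%N ->
     ~ exists L : lattice m, lrank L = 3%N /\ two_universal L.
  rewrite !inE => mN [L [L3 Lu]].
  have small c : ((m %% 4 \in [:: 1; 2]) && (c < m) || (4 * c < m))%N -> real_up_to m c.
    move=> cm x n xO xn nc; apply/eqP/negPn/negP => xN.
    have [m4n mn] := nonreal_norm_bound m_gt0 m_sqf xO xn xN.
    case/orP: cm => [/andP[/mn]|]; lia.
  have m4 : (m %% 4 != 0)%N by apply/negP => /(m_sqf 2).
  have sqrt_nonreal : quad_conj (quad_sqrt m) != quad_sqrt m.
    rewrite conj_quad_sqrt // eq_sym -subr_eq0 opprK -mulr2n -mulr_natl mulf_eq0.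
    by rewrite quad_natr_eq0 (negPf (quad_sqrt_neq0 m_gt0)).
  have := divn_eq m 8; have : (m %% 8 < 8)%N by rewrite ltn_mod.
  move: (m %/ 8)%N (m %% 8)%N => q r r8 mE.
  (* In each class, an integer b of small norm n that is not real, and c about
     n / 2, so that integers of norm at most c are real; for m = 7 mod 8
     the norm of b is even, which calls for the second kind of plane. *)
  have [r15|[r26|[r3|r7]]] : (r %% 4 = 1 \/ r %% 4 = 2 \/ r = 3 \/ r = 7)%N by lia.
  - apply: (no_odd_entry m_gt0 L3 Lu (b := quad_sqrt m) (n := m) (c := (m + 1) %/ 2)).
    + exact: quad_sqrt_int.
    + exact: sqrt_nonreal.
    + by rewrite conj_quad_sqrt // mulrN quad_sqrt2 opprK.
    + lia.
    + lia.
    + lia.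
    + apply: small; rewrite !inE; lia.
  - apply: (no_odd_entry m_gt0 L3 Lu (b := 1 + quad_sqrt m) (n := (m + 1)%N) (c := (m + 2) %/ 2)).
    + by rewrite rpredD ?rpred1 ?quad_sqrt_int.
    + by rewrite rmorphD rmorph1 (inj_eq (addrI _)).
    + have -> : quad_conj (1 + quad_sqrt m) = 1 - quad_sqrt m.
        by rewrite rmorphD rmorph1; congr (_ + _); apply: conj_quad_sqrt.
      by rewrite natrD -[m%:R]opprK -quad_sqrt2; ring.
    + lia.
    + lia.
    + lia.
    + apply: small; rewrite !inE; lia.
  - have mk : (m + 1 = 4 * ((m + 1) %/ 4))%N by lia.
    apply: (no_odd_entry m_gt0 L3 Lu (b := quad_half m) (n := (m + 1) %/ 4) (c := (m + 5) %/ 8)).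
    + exact: quad_half_int mk.
    + exact: conj_quad_half_neq.
    + exact: quad_half_norm.
    + lia.
    + lia.
    + lia.
    + apply: small; lia.
  - have mk : (m + 1 = 4 * (2 * ((m + 1) %/ 8)))%N by lia.
    apply: (no_even_entry m_gt0 L3 Lu (b := quad_half m) (c := (m + 1) %/ 8)).
    + exact: quad_half_int mk.
    + exact: conj_quad_half_neq.
    + exact: quad_half_norm.
    + lia.
    + apply: small; lia.
split=> // L L3 Lu.
have [mm|/nonexistence mN] := boolP (m \in [:: 1; 2; 3; 7; 11]%N); last by case: mN; exists L.
have [[e1 e2] /= [e1L e2L e11 e22 e12]] := orthonormal_pair Lu.
apply: (euclidean_free m_gt0 L3 Lu.1 e1L e2L e11 e22 e12) => x.
exact: quad_euclid.
Qed.
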